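(* Let $n\ge 7$ and $3\le k\le n-3$, and let $H$ be a strong $k$-tournament on $n$ vertices. Then there is a strong tournament $T\in\mathcal{T}_H$.
   Context: For $2\le k\le n$, a $k$-tournament $H$ on $n$ vertices is a pair $(V,A)$ where $V$ is a set of $n$ vertices and $A$ is a set of $k$-tuples of distinct vertices (hyperarcs) such that for every $k$-subset $S\subseteq V$, $A$ contains exactly one of the $k!$ orderings of $S$. For a hyperarc $a=(x_1\dots x_k)$, $x_i$ precedes $x_j$ in $a$ if $i<j$. A path in $H$ is an alternating sequence $x_1a_1x_2\dots x_ma_mx_{m+1}$ of distinct vertices and distinct hyperarcs with $x_i$ preceding $x_{i+1}$ in $a_i$; $H$ is strong if for every ordered pair $(u,v)$ of distinct vertices there is a path from $u$ to $v$. A tournament is a $2$-tournament, i.e. an orientation of the complete graph; it is strong if it is strongly connected. For a tournament $T$ with $V(T)=V(H)$, an arc $(u,v)$ of $T$ is generated by a hyperarc $a$ of $H$ if $u,v$ both lie in $a$ and $u$ precedes $v$ in $a$. $T$ is generated by $H$ if each arc of $T$ is generated by a hyperarc of $H$ assigned to it, with distinct arcs assigned distinct hyperarcs. $\mathcal{T}_H$ is the set of all tournaments generated by $H$. *)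

(* Defs.v *)
From mathcomp Require Import all_boot.
Set Implicit Arguments. Unset Strict Implicit. Unset Printing Implicit Defensive.

Definition precedes (V : finType) (k : nat) (a : k.-tuple V) (x y : V) : bool :=
  [&& x \in a, y \in a & index x a < index y a].

Definition is_ktournament (V : finType) (k : nat) (A : {set k.-tuple V}) : Prop :=
  (forall a, a \in A -> uniq a) /\
  (forall S : {set V}, #|S| = k ->
     exists! a : k.-tuple V, a \in A /\ [set x in a] = S).

(* A path x_1 a_1 x_2 ... a_m x_{m+1} from u to v in H = (V, A):
   xs = [x_1; ...; x_{m+1}], arcs = [a_1; ...; a_m]. *)
Definition hpath (V : finType) (k : nat) (A : {set k.-tuple V}) (u v : V)
    (xs : seq V) (arcs : seq (k.-tuple V)) : Prop :=
  size xs = (size arcs).+1 /\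
  head u xs = u /\ last u xs = v /\
  uniq xs /\ uniq arcs /\
  (forall a, a \in arcs -> a \in A) /\
  (forall a x y, (a, (x, y)) \in zip arcs (zip xs (behead xs)) ->
     precedes a x y).

Definition hstrong (V : finType) (k : nat) (A : {set k.-tuple V}) : Prop :=
  forall u v : V, u != v -> exists xs arcs, hpath A u v xs arcs.

Definition is_tournament (V : finType) (T : rel V) : Prop :=
  (forall x, ~~ T x x) /\ (forall x y : V, x != y -> T x y (+) T y x).

Definition tstrong (V : finType) (T : rel V) : Prop :=
  forall u v : V, connect T u v.

Definition generated_by (V : finType) (k : nat) (A : {set k.-tuple V})
    (T : rel V) : Prop :=
  exists f : V * V -> k.-tuple V,
    (forall p : V * V, T p.1 p.2 -> f p \in A /\ precedes (f p) p.1 p.2) /\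
    {in [pred p : V * V | T p.1 p.2] &, injective f}.

(* Main.v *)
(* An arc (u, v) is a majority arc when at least half of the hyperarcs over {u, v}
   put u before v. The majority digraph G is semicomplete, so it has a vertex s
   reaching all vertices and a vertex t reached from all of them; adding the arcs
   of a path of H from t to s, which come with distinct hyperarcs, makes it strong.
   The result has a Hamiltonian cycle, each arc of which is a majority arc or has
   a hyperarc reserved for it. Majority arcs have so many hyperarcs that the
   reserved ones extend greedily to distinct hyperarcs for the whole cycle, except
   when (n, k) = (7, 4). The remaining pairs need no particular orientation, so
   Hall's theorem completes the assignment.

   When (n, k) = (7, 4), Hall's theorem still handles the cycle if at most four of
   its arcs are not majority arcs. Otherwise the reversed cycle has at most two
   arcs that are not majority arcs; if it cannot be used either, then exchanging
   two consecutive vertices of the cycle, or a Hamiltonian cycle of G, works. *)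

Require Import Defs.
From mathcomp Require Import all_boot.
From mathcomp Require Import fingroup perm zify.
(* Restores [cycle] for paths, shadowed by cyclic groups. *)
From mathcomp Require Import path.
Set Implicit Arguments. Unset Strict Implicit. Unset Printing Implicit Defensive.

(** * Distinct representatives *)

Definition representatives (I T : finType) (N : I -> {set T}) (D : {set I}) (f : I -> T) :=
  {in D, forall i, f i \in N i} /\ {in D &, injective f}.

Lemma representatives_add (I T : finType) (N : I -> {set T}) (D : {set I}) f i t :
  representatives N D f -> i \notin D -> t \in N i -> t \notin f @: D ->
  exists2 h, representatives N (i |: D) h & h @: (i |: D) = t |: f @: D.
Proof.
move=> [fN finj] niD Nit nt.
pose h j := if j == i then t else f j.
have hD : {in D, h =1 f}.
  by move=> j Dj; rewrite /h; case: eqVneq => // e; rewrite -e Dj in niD.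
have hi : h i = t by rewrite /h eqxx.
exists h; last by rewrite imsetU1 hi (eq_in_imset hD).
split=> [j|j j']; rewrite !inE.
  by case/orP=> [/eqP ->|Dj]; rewrite ?hi ?hD //; apply: fN.
case/orP=> [/eqP ->|Dj]; case/orP=> [/eqP ->|Dj'] //; rewrite ?hi ?hD //.
- by move=> e; rewrite e imset_f in nt.
- by move=> e; rewrite -e imset_f in nt.
- exact: finj.
Qed.

Section Representatives.

Variables I T : finType.

(** Induction on [#|D|]. If some proper nonempty [S] is tight, [S] and [D :\: S] are represented
    separately, the latter outside the neighbours of [S]. Otherwise every such [S] has a spare
    neighbour, so any element of [N i] may be given to [i] and removed. [t0] supplies the value when
    [D] is empty. *)
Lemma hall_marriage (N : I -> {set T}) (D : {set I}) (t0 : T) :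
  (forall S : {set I}, S \subset D -> #|S| <= #|\bigcup_(i in S) N i|) ->
  exists f, representatives N D f.
Proof.
elim: {D}_.+1 {-2}D (ltnSn #|D|) N => // m IHm D ltDm N hallN.
have [->|[i Di]] := set_0Vmem D.
  by exists (fun=> t0); split=> [i|i j]; rewrite inE.
pose tight (S : {set I}) := [&& S \subset D, S != set0, S != D & #|\bigcup_(i in S) N i| <= #|S|].
have [/existsP[S /and4P[sSD S0 nSD tightS]]|/existsPn noTight] :=
  boolP [exists S, tight S].
- clear i Di; have ltSD : #|S| < #|D| by rewrite proper_card // properEneq nSD.
  have [S' sS'S|f [fN finj]] := IHm S (leq_trans ltSD ltDm) N.
    by apply: hallN; exact: subset_trans sS'S sSD.
  pose N' i := N i :\: \bigcup_(j in S) N j.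
  have ltDS : #|D :\: S| < m.
    by rewrite cardsD (setIidPr sSD); move: S0; rewrite -card_gt0; lia.
  have [S' sS'|g [gN ginj]] := IHm (D :\: S) ltDS N'.
    have := hallN (S :|: S'); rewrite subUset sSD.
    rewrite (subset_trans sS' (subsetDl _ _)) => /(_ isT).
    have dSS' : [disjoint S & S'].
      rewrite disjoint_sym; apply: disjointWl sS' _.
      by rewrite -setI_eq0 setIDAC -setIDA setDv setI0.
    have -> : #|S :|: S'| = #|S| + #|S'| by apply/eqP; rewrite (leq_card_setU S S').2.
    have -> : \bigcup_(i in S :|: S') N i =
       \bigcup_(j in S) N j :|: \bigcup_(i in S') N' i.
      apply/setP=> t; rewrite !inE; apply/bigcupP/orP.
        case=> j; rewrite inE => jSS Njt.
        case: (boolP (t \in \bigcup_(j in S) N j)) => tS; [by left|right].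
        case/orP: jSS => jS; first by case/negP: tS; apply/bigcupP; exists j.
        by apply/bigcupP; exists j => //; rewrite inE tS.
      by case=> /bigcupP[j jS Njt]; exists j; rewrite ?inE ?jS ?orbT //; case/setDP: Njt.
    move=> hS; have := leq_trans hS (leq_card_setU _ _).1.
    by move: tightS; lia.
  exists (fun i => if i \in S then f i else g i); split=> [i Di'|i j Di' Dj].
    case: ifP => [/fN //|niS].
    by have /gN/setDP[] : i \in D :\: S by rewrite inE niS.
  case: ifP => iS; case: ifP => jS.
  - exact: finj.
  - have /gN/setDP[_ /bigcupP nj] : j \in D :\: S by rewrite inE jS.
    by move=> e; case: nj; exists i => //; rewrite -e fN.
  - have /gN/setDP[_ /bigcupP nj] : i \in D :\: S by rewrite inE iS.
    by move=> e; case: nj; exists j => //; rewrite e fN.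
  - by apply: ginj; rewrite inE ?iS ?jS.
- have [t Nit] : exists t, t \in N i.
    apply/set0Pn; rewrite -card_gt0; have := hallN [set i].
    by rewrite sub1set big_set1 cards1; apply.
  pose N' j := N j :\ t.
  have ltDi : #|D :\ i| < m by rewrite (cardsD1 i) Di in ltDm.
  have [S sS|g [gN ginj]] := IHm (D :\ i) ltDi N'.
    have [->|S0] := eqVneq S set0; first by rewrite cards0.
    have ltS : #|S| < #|\bigcup_(j in S) N j|.
      rewrite ltnNge; apply/negP=> le; case/negP: (noTight S); rewrite /tight S0 le.
      rewrite (subset_trans sS (subsetDl _ _)) andbT /=.
      by apply: contraTneq sS => ->; apply/subsetPn; exists i; rewrite // !inE eqxx.
    have sub : \bigcup_(j in S) N j \subset t |: \bigcup_(j in S) N' j.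
      apply/bigcupsP=> j jS; apply/subsetP=> t' Njt'; rewrite !inE.
      case: eqVneq => //= nt; apply/bigcupP; exists j => //.
      by rewrite !inE nt.
    have := subset_leq_card sub; rewrite cardsU1; move: ltS.
    by case: (_ \notin _); lia.
  exists (fun j => if j == i then t else g j); split=> [j Dj|j j' Dj Dj'].
    case: eqVneq => [-> //|ni].
    by have /gN/setD1P[] : j \in D :\ i by rewrite !inE ni.
  case: eqVneq => [->|ni]; case: eqVneq => [->|ni'] //.
  - have /gN/setD1P[+ _] : j' \in D :\ i by rewrite !inE ni'.
    by move=> /eqP + e; rewrite e.
  - have /gN/setD1P[+ _] : j \in D :\ i by rewrite !inE ni.
    by move=> /eqP + e; rewrite e.
  - by apply: ginj; rewrite !inE ?ni ?ni'.
Qed.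

(** Greedy choice: indices outside [D] are added one by one, and the second hypothesis keeps an
    element of [N i] free whatever was chosen before. *)
Lemma extend_representatives (N : I -> {set T}) (D : {set I}) (f : I -> T) :
  representatives N D f ->
  (forall i (J : {set I}) h, i \notin D -> i \notin J ->
     representatives N J h -> #|N i :&: h @: J| < #|N i|) ->
  exists g, representatives N setT g.
Proof.
move=> fD few.
suff main m (J : {set I}) : #|~: J| < m -> D \subset J -> forall h,
    representatives N J h -> exists g, representatives N setT g.
  exact: (main _ D (ltnSn _) (subxx _) f).
elim: m J => // m IHm J ltJ sDJ {fD}f fJ.
have [J0|[i]] := set_0Vmem (~: J).
  by exists f; rewrite -setC0 -J0 setCK.
rewrite inE => niJ.
have [t Nit ntJ] : exists2 t, t \in N i & t \notin f @: J.
  apply/subsetPn; apply/negP=> /setIidPl E.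
  have := few i J f _ niJ fJ; rewrite E ltnn => H.
  by apply/notF/H; apply: contra niJ; apply: (subsetP sDJ).
have [h hP _] := representatives_add fJ niJ Nit ntJ.
apply: (IHm (i |: J) _ _ h hP); last exact: subset_trans (subsetUr _ _).
by have := cardsC J; have := cardsC (i |: J); rewrite cardsU1 niJ; lia.
Qed.

End Representatives.

Lemma representatives_cat (I T : finType) (N : I -> {set T}) (D : {set I}) f h :
  representatives N D f -> representatives (fun i => N i :\: f @: D) (~: D) h ->
  exists g, representatives N setT g.
Proof.
move=> [fN finj] [hN hinj]; exists (fun i => if i \in D then f i else h i).
have hN' i : i \notin D -> h i \in N i /\ h i \notin f @: D.
  by move=> niD; have := hN i; rewrite inE niD => /(_ isT)/setDP.
split=> [i _|i j _ _]; first by case: ifPn => [/fN|/hN'[]].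
case: ifPn => iD; case: ifPn => jD.
- exact: finj.
- by have [_] := hN' _ jD => + e; rewrite -e imset_f.
- by have [_] := hN' _ iD => + e; rewrite e imset_f.
- by apply: hinj; rewrite inE.
Qed.

(** Hall's condition for two sets: the remainders are nonempty and cannot be one common singleton,
    because one of them has at least two elements. *)
Lemma two_representatives (I T : finType) (N : I -> {set T}) (D : {set I}) f i j :
  representatives N D f -> i \notin D -> j \notin D -> i != j ->
  0 < #|N i :\: f @: D| -> 0 < #|N j :\: f @: D| ->
  2 < #|N i :\: f @: D| + #|N j :\: f @: D| ->
  exists h, representatives N (i |: (j |: D)) h.
Proof.
move=> fD niD njD nij; set X := N i :\: _; set Y := N j :\: _ => X0 Y0 XY.
have [x [y [Xx Yy xy]]] : exists x y, [/\ x \in X, y \in Y & x != y].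
  have [X1|Y1] : 1 < #|X| \/ 1 < #|Y| by lia.
    have /card_gt0P[y Yy] := Y0.
    have : 0 < #|X :\ y| by have := cardsD1 y X; case: (_ \in _); lia.
    by case/card_gt0P=> x /setD1P[xy Xx]; exists x, y.
  have /card_gt0P[x Xx] := X0.
  have : 0 < #|Y :\ x| by have := cardsD1 x Y; case: (_ \in _); lia.
  by case/card_gt0P=> y /setD1P[yx Yy]; exists x, y; rewrite eq_sym.
case/setDP: Yy => Ny nyD; case/setDP: Xx => Nx nxD.
have [h hP hE] := representatives_add fD njD Ny nyD.
have [|||h' h'P _] := @representatives_add _ _ N (j |: D) h i x hP; last by exists h'.
- by rewrite in_setU1 negb_or nij.
- by [].
- by rewrite hE in_setU1 negb_or xy.
Qed.

(** * Hamiltonian cycles of semicomplete digraphs *)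

Section StrongRelations.

Variables (V : finType) (e : rel V).

Lemma connect_exit (P : {pred V}) x y :
  connect e x y -> x \in P -> y \notin P ->
  exists u v, [/\ u \in P, v \notin P & e u v].
Proof.
case/connectP=> p; elim: p x => [|z p IHp] x /=; first by move=> _ -> ->.
case/andP=> exz ep ly Px nPy.
have [Pz|nPz] := boolP (z \in P); first exact: IHp Pz nPy.
by exists x, z.
Qed.

(** A vertex with the largest reachable set works: if it missed [v], totality would give an arc from
    [v] to it, and [v] would reach strictly more. *)
Lemma total_source (x0 : V) : total e -> exists s, forall v, connect e s v.
Proof.
move=> tot; pose s := [arg max_(s > x0) #|connect e s|].
exists s => v; apply/negPn/negP=> nsv.
have evs : e v s by case/orP: (tot v s) => // /connect1; rewrite (negPf nsv).
have : #|connect e v| <= #|connect e s|.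
  by rewrite /s; case: arg_maxnP => // i _; apply.
rewrite leqNgt; case/negP; apply: proper_card; apply/properP; split.
  by apply/subsetP=> z; apply: connect_trans; apply: connect1.
by exists v => //; rewrite inE.
Qed.

Hypotheses (tot : total e) (strong : forall u v, connect e u v).

(** If [w] fits between no two consecutive vertices, totality propagates arcs into [w] from [y]
    around the whole cycle; the predecessor of [z] then contradicts the arc from [w] to [z]. *)
Lemma cycle_insert1 c y z w : uniq c -> cycle e c -> w \notin c ->
  y \in c -> z \in c -> e y w -> e w z ->
  exists c', [/\ uniq c', cycle e c' & size c < size c'].
Proof.
move=> Uc ec ncw cy cz eyw ewz.
have [y1 [cy1 ey1 ewn]] : exists y1, [/\ y1 \in c, e y1 w & e w (next c y1)].
  have [/hasP[y1 cy1 /andP[]]|/hasPn nex] :=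
    boolP (has (fun y1 => e y1 w && e w (next c y1)) c); first by exists y1.
  have step u : u \in c -> e u w -> e (next c u) w.
    move=> cu eu; have := nex u cu; rewrite eu /= => /negPf nu.
    by case/orP: (tot (next c u) w) => //; rewrite nu.
  have all u : u \in c -> e u w.
    move=> cu; have : fconnect (next c) y u.
      by rewrite (fconnect_cycle (cycle_next Uc) cy).
    case/connectP=> p + ->; elim: p y cy eyw => //= v p IHp y' cy' ey'.
    case/andP=> /eqP <- ; apply: IHp; rewrite ?mem_next //; exact: step.
  have := nex (prev c z); rewrite mem_prev => /(_ cz).
  by rewrite next_prev // all ?mem_prev // ewz.
have [i q Dq] := rot_to cy1.
exists (y1 :: w :: q).
have Uq : uniq (y1 :: q) by rewrite -Dq rot_uniq.
have cq : cycle e (y1 :: q) by rewrite -Dq rot_cycle.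
have ncq : w \notin y1 :: q by rewrite -Dq mem_rot.
have sq : size c = (size q).+1 by rewrite -(size_rot i) Dq.
have nq : next c y1 = head y1 (rcons q y1).
  rewrite -(next_rot i Uc) Dq /=; by case: (q) => [|a q'] /=; rewrite eqxx.
split; last by rewrite sq.
- move: Uq ncq; rewrite /= !inE !negb_or eq_sym => /andP[-> ->] /andP[-> ->] //.
- move: cq ewn; rewrite nq /= ey1 /=.
  by case: (q) => [|a q'] /=; [move=> _ -> | move=> /andP[_ ->] ->].
Qed.

Lemma cycle_insert2 c a b : uniq c -> cycle e c -> c != [::] ->
  a \notin c -> b \notin c -> a != b ->
  {in c, forall y, e y a} -> {in c, forall y, e b y} -> e a b ->
  exists c', [/\ uniq c', cycle e c' & size c < size c'].
Proof.
case: c => // y q Uc ec _ nca ncb nab ya yb eab.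
exists (y :: a :: b :: q); split; last by rewrite /= !ltnS leqnSn.
  by move: Uc nca ncb; rewrite /= !inE !negb_or nab !(eq_sym _ y) => /andP[-> ->] /andP[-> ->] /andP[-> ->].
move: ec; rewrite /= eab ya ?inE ?eqxx //=.
have := yb y (mem_head y q).
case: q yb {Uc nca ncb ya} => [|z q] yb /=; first by move=> ->.
by move=> _ /andP[_ ->]; rewrite yb // !inE eqxx orbT.
Qed.

(* A longest cycle is Hamiltonian: a vertex outside it with arcs to and from it
   can be inserted, otherwise an arc leads from a vertex dominated by the cycle
   to a vertex dominating it, and both can be inserted. *)
Lemma hamiltonian_cycle (x0 : V) : exists c,
  [/\ uniq c, cycle e c & forall v, v \in c].
Proof.
have exc : exists m, [exists t : m.-tuple V, uniq t && cycle e t] && (0 < m).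
  (* Totality at equal arguments gives a loop at [x0], so one vertex already counts as a cycle. *)
  exists 1; rewrite andbT; apply/existsP; exists [tuple x0] => /=.
  by have := tot x0 x0; rewrite orbb => ->.
have bound m : [exists t : m.-tuple V, uniq t && cycle e t] && (0 < m) -> m <= #|V|.
  case/andP=> /existsP[t /andP[Ut _]] _.
  by rewrite -(size_tuple t) -(card_uniqP Ut) max_card.
case: (ex_maxnP exc bound) => m /andP[/existsP[t /andP[Ut ct]] m0] maxm.
have noext c' : uniq c' -> cycle e c' -> size t < size c' -> False.
  rewrite size_tuple => Uc cc lt; have := maxm (size c').
  rewrite (leq_trans _ lt) // andbT leqNgt lt => H; apply/notF/H.
  by apply/existsP; exists (in_tuple c'); rewrite Uc.
exists t; split=> // v; apply/negPn/negP=> ntv.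
have [x tx] : exists x, x \in tval t.
  by case: (tval t) (size_tuple t) m0 => [<-|x s] //; exists x; rewrite inE eqxx.
have noins y z w : w \notin tval t -> y \in tval t -> z \in tval t ->
    e y w -> e w z -> False.
  move=> ntw ty tz ew ez.
  by have [c' []] := cycle_insert1 Ut ct ntw ty tz ew ez; apply: noext.
have [y [w [ty ntw eyw]]] := connect_exit (strong x v) tx ntv.
(* [w] lies in [A] and [x] does not, so a path from [w] to [x] leaves [A] along an arc from [a] to
   [b]; then [b] is off the cycle and has an arc into it. *)
pose A := [pred a | (a \notin tval t) && all (fun z => ~~ e a z) t].
have Aw : w \in A.
  by rewrite inE ntw /=; apply/allP=> z tz; apply/negP; apply: noins eyw.
have nAx : x \notin A by rewrite inE tx.
have [a [b [Aa nAb eab]]] := connect_exit (strong w x) Aw nAx.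
case/andP: (Aa) => nta /allP nea.
have ntb : b \notin tval t by apply/negP=> /nea; rewrite eab.
have [z tz ebz] : exists2 z, z \in tval t & e b z.
  by apply/hasP; move: nAb; rewrite inE ntb /= -has_predC; apply: sub_has => z /=; rewrite negbK.
have ya : {in t, forall y, e y a}.
  by move=> u tu; case/orP: (tot u a) => // /idPn; rewrite nea.
have yb : {in t, forall y, e b y}.
  move=> u tu; case/orP: (tot b u) => // eub; case: (noins u z b) => //.
have [||c' []] := cycle_insert2 Ut ct _ nta ntb _ ya yb eab.
- by apply: contraTneq tx => ->.
- by apply: contraNneq nAb => <-.
- exact: noext.
Qed.

(** The cycle is recorded by its successor permutation: a single orbit expresses that it is
    Hamiltonian, and its arcs [(v, s v)] become indexed by vertices. *)
Lemma hamiltonian_perm (x0 : V) : exists s : {perm V},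
  (forall v, e v (s v)) /\ (forall u v, fconnect s u v).
Proof.
have [c [Uc ec cV]] := hamiltonian_cycle x0.
have ninj : injective (next c) by apply: can_inj (prev_next Uc).
exists (perm ninj); split=> [v|u v]; first by rewrite permE; apply: next_cycle.
rewrite (eq_fconnect (permE ninj)) (fconnect_cycle (cycle_next Uc)) //.
Qed.

End StrongRelations.

(** * Counting hyperarcs *)

Lemma sum_card_exchange (I T : finType) (S : {set I}) (U : {set T}) (F : I -> {set T}) :
  {in S, forall i, F i \subset U} ->
  \sum_(i in S) #|F i| = \sum_(a in U) #|[set i in S | a \in F i]|.
Proof.
move=> FU.
under eq_bigr => i _ do rewrite -sum1_card.
under [RHS]eq_bigr => a _ do rewrite -sum1_card.
rewrite (exchange_big_dep (mem U)) /= => [|i a Si Fa]; last by apply: subsetP Fa; apply: FU.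
by apply: eq_bigr => a _; apply: eq_bigl => i; rewrite !inE.
Qed.

Lemma cardsU_ge (T : finType) (B C U : {set T}) m :
  B \subset U -> C \subset U -> #|B :&: C| <= m -> #|B| + #|C| <= #|U| + m.
Proof.
move=> BU CU; rewrite -cardsUI.
have : #|B :|: C| <= #|U| by rewrite subset_leq_card // subUset BU.
lia.
Qed.

Lemma cardsU3_ge (T : finType) (B C D U : {set T}) m :
  B \subset U -> C \subset U -> D \subset U ->
  #|B :&: C| <= m -> #|B :&: D| <= m -> #|C :&: D| <= m ->
  #|B| + #|C| + #|D| <= #|U| + 3 * m.
Proof.
move=> BU CU DU BC BD CD.
have h1 : #|B :|: C :|: D| <= #|U| by rewrite subset_leq_card // !subUset BU CU.
have := cardsUI B C; have := cardsUI (B :|: C) D.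
rewrite setIUl; have := leq_card_setU (B :&: D) (C :&: D) => -[+ _]; lia.
Qed.

Section Hypertournament.

Variables (V : finType) (k : nat) (A : {set k.-tuple V}).
Hypothesis (HA : is_ktournament A).

Definition hyperarcs_over (P : {set V}) := [set a in A | P \subset [set x in a]].

Definition hyperarcs_from (u v : V) := [set a in A | precedes a u v].

Local Notation sup := hyperarcs_over.
Local Notation arcs := hyperarcs_from.

Lemma supp_inj : {in A &, injective (fun a : k.-tuple V => [set x in a])}.
Proof.
move=> a b Aa Ab /= ab; case: (HA) => uA exA.
have [|c [_ cu]] := exA [set x in a].
  by rewrite cardsE (card_uniqP (uA _ Aa)) size_tuple.
by rewrite -(cu a) // -(cu b).
Qed.

Lemma card_supp a : a \in A -> #|[set x in a]| = k.
Proof.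
by case: (HA) => uA _ Aa; rewrite cardsE (card_uniqP (uA _ Aa)) size_tuple.
Qed.

(** Removing [P] from supports is a bijection onto the subsets of size [k - #|P|] of its complement,
    since each [k]-subset supports exactly one hyperarc. *)
Lemma card_hyperarcs_over (P : {set V}) : #|P| <= k -> #|sup P| = 'C(#|V| - #|P|, k - #|P|).
Proof.
move=> Pk; pose h (a : k.-tuple V) := [set x in a] :\: P.
have -> : #|V| - #|P| = #|~: P| by rewrite -(cardsC P) addKn.
rewrite -cards_draws -(card_in_imset (f := h)); last first.
  move=> a b; rewrite !inE => /andP[Aa Pa] /andP[Ab Pb] hab.
  apply: supp_inj => //=.
  by rewrite -(setID [set x in a] P) -(setID [set x in b] P) (setIidPr Pa) (setIidPr Pb) -/(h a) hab.
apply: eq_card => B; apply/imsetP/idP => [[a]|].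
  rewrite !inE => /andP[Aa Pa] ->; rewrite cardsD (setIidPr Pa) card_supp // eqxx andbT.
  by rewrite /h setDE subsetIr.
rewrite inE => /andP[BP /eqP cB].
have dPB : P :&: B = set0 by apply/eqP; rewrite setI_eq0 disjoints_subset subsetC.
have [|a [[Aa aPB] _]] := HA.2 (P :|: B).
  by rewrite cardsU dPB cards0 subn0 cB subnKC.
exists a; first by rewrite inE Aa aPB subsetUl.
by rewrite /h aPB setDUl setDv set0U; apply/esym/setDidPl; rewrite -setI_eq0 setIC dPB.
Qed.

Lemma hyperarcs_from_sub u v : arcs u v \subset sup [set u; v].
Proof.
apply/subsetP=> a; rewrite !inE => /andP[-> /and3P[ua va _]].
by apply/subsetP=> x; rewrite !inE => /orP[] /eqP ->.
Qed.

Lemma hyperarcs_fromP u v a : a \in arcs u v -> [/\ a \in A, u \in a & v \in a].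
Proof. by rewrite inE => /and4P[-> -> ->]. Qed.

Lemma precedes_total (a : k.-tuple V) u v : u != v -> u \in a -> v \in a -> precedes a u v (+) precedes a v u.
Proof.
move=> nuv ua va; rewrite /precedes ua va /=.
have : index u a != index v a.
  by apply: contra_neq nuv => e; rewrite -(nth_index u ua) e nth_index.
by case: ltngtP.
Qed.

Lemma precedes_trans (a : k.-tuple V) u v w : precedes a u v -> precedes a v w -> precedes a u w.
Proof.
by case/and3P=> ua va uv /and3P[_ wa vw]; rewrite /precedes ua wa (ltn_trans uv vw).
Qed.

Lemma card_hyperarcs_from u v : u != v ->
  #|arcs u v| + #|arcs v u| = #|sup [set u; v]|.
Proof.
move=> nuv.
have -> : sup [set u; v] = arcs u v :|: arcs v u.
  apply/eqP; rewrite eqEsubset subUset hyperarcs_from_sub (setUC [set u]) hyperarcs_from_sub !andbT.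
  apply/subsetP=> a; rewrite !inE subUset !sub1set !inE => /and3P[-> va ua] /=.
  by have := precedes_total nuv ua va; do 2!case: precedes.
rewrite cardsU; set X := _ :&: _; suff -> : X = set0 by rewrite cards0 subn0.
apply/setP=> a; rewrite !inE; apply/negbTE/negP=> /andP[/andP[_ p1] /andP[_ p2]].
case/and3P: (p1) => ua va _.
by have := precedes_total nuv ua va; rewrite p1 p2.
Qed.

Lemma hyperarcs_overI (P Q : {set V}) : sup P :&: sup Q = sup (P :|: Q).
Proof. by apply/setP=> a; rewrite !inE subUset; case: (a \in A). Qed.

Lemma hyperarcs_overS (P Q : {set V}) : P \subset Q -> sup Q \subset sup P.
Proof.
by move=> PQ; apply/subsetP=> a; rewrite !inE => /andP[->]; apply: subset_trans.
Qed.

Lemma card_pairs_under a : a \in A ->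
  #|[set P : {set V} | P \subset [set x in a] & #|P| == 2]| = 'C(k, 2).
Proof. by move=> Aa; rewrite cards_draws card_supp. Qed.

Lemma card_hyperarcs_over_ge (P : {set V}) m : m <= #|P| -> m <= k ->
  #|sup P| <= 'C(#|V| - m, k - m).
Proof.
move=> mP mk.
have /set0Pn[Q] : [set Q : {set V} | Q \subset P & #|Q| == m] != set0.
  by rewrite -card_gt0 cards_draws bin_gt0.
rewrite inE => /andP[QP /eqP cQ].
have -> : 'C(#|V| - m, k - m) = #|sup Q| by rewrite card_hyperarcs_over cQ.
exact/subset_leq_card/hyperarcs_overS.
Qed.

Lemma card_pairU (P Q : {set V}) : #|P| = 2 -> #|Q| = 2 -> P != Q -> 2 < #|P :|: Q|.
Proof.
move=> cP cQ nPQ; rewrite ltnNge; apply/negP=> le; case/negP: nPQ; apply/eqP.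
have E : P :|: Q = P.
  by apply/esym/eqP; rewrite eqEcard subsetUl cP.
apply/esym/eqP; rewrite eqEcard cP cQ leqnn andbT -E; exact: subsetUr.
Qed.

Lemma card_hyperarcs_overI (P Q : {set V}) : 2 < k -> #|P| = 2 -> #|Q| = 2 -> P != Q ->
  #|sup P :&: sup Q| <= 'C(#|V| - 3, k - 3).
Proof.
move=> k3 cP cQ nPQ; rewrite hyperarcs_overI.
by apply: card_hyperarcs_over_ge => //; apply: card_pairU.
Qed.

End Hypertournament.

(** * From a Hamiltonian cycle to a strong tournament *)

(** Meant for [m = n - 2] and [j = k - 2], where ['C(m, j)] counts the hyperarcs over a pair: the
    first bound serves Hall's condition off the cycle, the second the greedy choice on it. Away from
    the boundary [j = m - 3], Pascal's rule gives both by induction on [m]. *)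
Lemma bin_ge_quadratic m j : 5 < m -> 1 < j -> j + 3 <= m ->
  'C(j + 2, 2) + m + 2 <= 'C(m, j) /\ 2 * m + 3 <= 'C(m, j).
Proof.
move=> m5; rewrite -(subnK m5).
elim: (m - 6) j => [|d IHd] j j1 jm.
  by have [->|->] : j = 2 \/ j = 3 by lia.
have [jd|jd] := leqP (j + 3) (d + 6).
  have [IH1 IH2] := IHd j j1 jd.
  case: j j1 {jm} jd IH1 IH2 => // j j1 jd IH1 IH2.
  have -> : 'C(d.+1 + 6, j.+1) = 'C(d + 6, j.+1) + 'C(d + 6, j) by rewrite addSn binS.
  suff : 1 < 'C(d + 6, j) by lia.
  case: j j1 {IH1 IH2} jd => // j _ jd.
  have E : 1 + (d + 5) = d + 6 by lia.
  have := @leq_bin2l (j.+2) (d + 6) j.+1.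
  have : 1 < 'C(j.+2, j.+1) by rewrite binSn.
  by move=> h1 h2; apply: leq_trans h1 (h2 _); lia.
(* On the boundary, symmetry turns the binomial into ['C(m, 3)], which a separate induction
   bounds. *)
have -> : j = d + 4 by lia.
have E : 'C(d.+1 + 6, d + 4) = 'C(d.+1 + 6, 3).
  by rewrite -bin_sub; [congr 'C(_, _)|]; lia.
have -> : d + 4 + 2 = d + 6 by lia.
rewrite {}E; elim: d {IHd j j1 jm jd} => // d [IH1 IH2].
have E3 : 'C(d.+2 + 6, 3) = 'C(d.+1 + 6, 3) + 'C(d.+1 + 6, 2) by rewrite addSn binS.
have E2 : 'C(d.+1 + 6, 2) = 'C(d + 6, 2) + (d + 6) by rewrite addSn binS bin1.
rewrite E3 E2; have := @leq_bin2l 6 (d + 6) 2; rewrite -['C(6, 2)]/15.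
lia.
Qed.

Section Completion.

Variables (V : finType) (k : nat) (A : {set k.-tuple V}).
Hypothesis (HA : is_ktournament A).

Local Notation sup := (hyperarcs_over A).
Local Notation arcs := (hyperarcs_from A).
Local Notation n := #|V|.

Variables (s : {perm V}) (g : V -> k.-tuple V).
Hypotheses (sc : forall u v, fconnect s u v).

Lemma transitive_fcycle p : fcycle s p -> p != [::] -> n <= size p.
Proof.
case: p => // x p /order_le_cycle/(_ x (mem_head x p)) + _; apply: leq_trans.
by rewrite /order; apply: eq_leq; apply: eq_card => y; rewrite !inE sc.
Qed.

Lemma transitive_neq v : 1 < n -> s v != v.
Proof.
move=> n1; apply/eqP=> e; have := @transitive_fcycle [:: v].
by rewrite /= e eqxx => /(_ isT isT); rewrite leqNgt n1.
Qed.

Lemma transitive_neq2 v : 2 < n -> s (s v) != v.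
Proof.
move=> n2; apply/eqP=> e; have := @transitive_fcycle [:: v; s v].
by rewrite /= e !eqxx => /(_ isT isT); rewrite leqNgt n2.
Qed.

Hypotheses (gs : forall v, g v \in arcs v (s v)) (ginj : injective g).
Hypotheses (n3 : 2 < n) (k3 : 2 < k).

Definition cycle_pairs := [set [set v; s v] | v : V].
Definition other_pairs := [set P : {set V} | (#|P| == 2) && (P \notin cycle_pairs)].
Definition used_hyperarcs := g @: setT.

Local Notation D := other_pairs.
Local Notation R := used_hyperarcs.
Local Notation N' P := (sup P :\: R).

(** Arcs of the cycle follow [s], which makes [T] strong; any other pair takes the direction in
    which its representative lists it, so that hyperarc generates the arc. Representatives avoid
    [R], hence differ from the hyperarcs of the cycle. *)
Lemma complete_cycle (h : {set V} -> k.-tuple V) :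
  {in D, forall P, h P \in N' P} -> {in D &, injective h} ->
  exists T : rel V, [/\ is_tournament T, generated_by A T & tstrong T].
Proof.
move=> hN hinj.
pose T u v := (u != v) && (if v == s u then true else if u == s v then false
                            else precedes (h [set u; v]) u v).
have Tpair u v : u != v -> v != s u -> u != s v -> [set u; v] \in D.
  move=> uv vu uv'; rewrite inE cards2 uv /=; apply/negP=> /imsetP[w _ e].
  have := set21 u v; have := set22 u v; rewrite e !inE.
  case/orP=> /eqP ev; case/orP=> /eqP eu; move: uv vu uv'; rewrite ev eu ?eqxx //.
have Tin u v : [set u; v] \in D ->
    [/\ h [set u; v] \in A, h [set u; v] \notin R, u \in h [set u; v] & v \in h [set u; v]].
  move=> /hN; rewrite !inE => /and3P[-> -> ]; rewrite subUset !sub1set !inE.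
  by case/andP.
have s2 v : s (s v) != v by apply: transitive_neq2.
exists T; split.
- split=> [x|x y xy]; first by rewrite /T eqxx.
  rewrite /T xy [y == x]eq_sym xy /=.
  case: eqVneq => [->|nyx]; first by rewrite eq_sym (negPf (s2 x)).
  case: eqVneq => // nxy.
  have [_ _ xh yh] := Tin _ _ (Tpair _ _ xy nyx nxy).
  by rewrite [in X in _ (+) X]setUC precedes_total.
- exists (fun p => if p.2 == s p.1 then g p.1 else h [set p.1; p.2]); split.
    move=> [u v] /= /andP[uv]; case: eqVneq => [-> _|vu].
      by have := gs u; rewrite inE => /andP.
    case: eqVneq => // uv' ->; split=> //.
    by have [] := Tin _ _ (Tpair _ _ uv vu uv').
  move=> [u v] [u' v']; rewrite !inE /T /=.
  move=> /andP[uv]; case: eqVneq => [->|vu] Tuv /andP[uv']; case: eqVneq => [->|vu'] Tuv'.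
  + by move/ginj->.
  + move: Tuv'; case: eqVneq => // uv2 _ e.
    have [_ + _ _] := Tin _ _ (Tpair _ _ uv' vu' uv2).
    by rewrite -e imset_f ?inE.
  + move: Tuv; case: eqVneq => // uv2 _ e.
    have [_ + _ _] := Tin _ _ (Tpair _ _ uv vu uv2).
    by rewrite e imset_f ?inE.
  + move: Tuv Tuv'; case: eqVneq => // uv2 p; case: eqVneq => // uv2' p' e.
    have E : [set u; v] = [set u'; v'] by apply: hinj e; apply: Tpair.
    have := set21 u v; have := set22 u v; rewrite E !inE.
    case/orP=> /eqP ev; case/orP=> /eqP eu; rewrite ?ev ?eu //.
    * by rewrite ev eu eqxx in uv.
    * move: p; rewrite E ev eu => p.
      have [_ _ uh vh] := Tin _ _ (Tpair _ _ uv' vu' uv2').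
      by have := precedes_total uv' uh vh; rewrite p p'.
    * by rewrite ev eu eqxx in uv.
- move=> u v; case/connectP: (sc u v) => p pp ->; apply/connectP; exists p => //.
  apply: sub_path pp => x y /eqP <-.
  by rewrite /T eqxx eq_sym transitive_neq // ltnW.
Qed.

Lemma card_used_hyperarcs : #|R| = n.
Proof. by rewrite card_imset // cardsT. Qed.

Lemma used_sub : R \subset A.
Proof. by apply/subsetP=> _ /imsetP[v _ ->]; have := gs v; rewrite inE => /andP[]. Qed.

(** Double counting of the pairs of [S] inside hyperarcs. A hyperarc contains ['C(k, 2)] pairs, but
    a used one contains the pair of its own cycle arc, which is not in [S]; hence the
    predecessor. *)
Lemma hyperarcs_over_pairs_weight (S : {set {set V}}) : S \subset D ->
  #|S| * 'C(n - 2, k - 2) <=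
  'C(k, 2) * #|\bigcup_(P in S) N' P| + n * ('C(k, 2)).-1.
Proof.
move=> SD; set U := \bigcup_(P in S) _.
have sup2 P : P \in S -> #|sup P| = 'C(n - 2, k - 2).
  move=> /(subsetP SD); rewrite inE => /andP[/eqP c2 _].
  by rewrite card_hyperarcs_over // c2 // ltnW.
have -> : #|S| * 'C(n - 2, k - 2) = \sum_(P in S) #|N' P| + \sum_(P in S) #|sup P :&: R|.
  rewrite -big_split /= -sum_nat_const; apply: eq_bigr => P SP.
  by rewrite -(sup2 P SP) -(cardsID R (sup P)) addnC.
have under a : a \in A -> #|[set P in S | P \subset [set x in a]]| <= 'C(k, 2).
  move=> Aa; rewrite -(card_pairs_under HA Aa); apply/subset_leq_card/subsetP=> P.
  by rewrite !inE => /andP[/(subsetP SD) + ->]; rewrite inE => /andP[->].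
apply: leq_add.
  rewrite (@sum_card_exchange _ _ _ U) => [|P SP]; last exact: (bigcup_sup P).
  rewrite mulnC -sum_nat_const; apply: leq_sum => a aU.
  have Aa : a \in A by case/bigcupP: aU => P _; rewrite !inE => /and3P[].
  apply: leq_trans (under a Aa); apply/subset_leq_card/subsetP=> P.
  by rewrite !inE => /and4P[-> _ _ ->].
rewrite (@sum_card_exchange _ _ _ R) => [|P SP]; last exact: subsetIr.
rewrite -card_used_hyperarcs -sum_nat_const; apply: leq_sum => a Ra.
have Aa := subsetP used_sub a Ra.
case/imsetP: (Ra) => v _ av.
rewrite -ltnS prednK ?bin_gt0 ?(ltnW k3) // -(card_pairs_under HA Aa).
apply: proper_card; apply/properP; split.
  apply/subsetP=> P; rewrite !inE -!andbA => /and4P[/(subsetP SD) + _ -> _].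
  by rewrite inE => /andP[->].
have [_ va sva] := hyperarcs_fromP (gs v); rewrite -av in va sva.
exists [set v; s v].
  by rewrite inE subUset !sub1set !inE va sva cards2 (eq_sym v) transitive_neq // ltnW.
rewrite inE negb_and; apply/orP; left; apply/negP=> /(subsetP SD).
by rewrite inE [X in _ && ~~ X](_ : _ = true) ?andbF //; apply/imsetP; exists v.
Qed.

Lemma hyperarcs_over_pairs_loss (S : {set {set V}}) :
  #|\bigcup_(P in S) sup P| <= #|\bigcup_(P in S) N' P| + n.
Proof.
rewrite -card_used_hyperarcs; apply: leq_trans (leq_card_setU _ _).1.
apply/subset_leq_card/bigcupsP=> P SP; apply/subsetP=> a aP; rewrite inE.
have [aR|naR] := boolP (a \in R); rewrite ?orbT // orbF.
by apply/bigcupP; exists P => //; rewrite inE naR.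
Qed.

(* A 3-hyperarc over {u, v} used for an arc of the cycle meets that arc in u or v. *)
Lemma triples_over_pair_loss P : k = 3 -> P \in D -> #|sup P| <= #|N' P| + 4.
Proof.
move=> k_3; rewrite inE => /andP[/cards2P[u [v [uv ->]]] _].
rewrite -(cardsID R) addnC leq_add2l.
pose W := [set u; v; (s^-1)%g u; (s^-1)%g v].
apply: (@leq_trans #|g @: W|); last first.
  apply: leq_trans (leq_imset_card _ _) _.
  rewrite /W -[_ :|: [set (s^-1)%g u]]setUA; apply: leq_trans (leq_card_setU _ _).1 _.
  by rewrite (cards1 _) addn1 ltnS; apply: leq_trans (leq_card_setU _ _).1 _;
   rewrite cards1 cards2; case: (_ != _).
apply/subset_leq_card/subsetP=> a /setIP[+ /imsetP[w _ aw]].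
rewrite inE => /andP[Aa]; rewrite subUset !sub1set !inE => /andP[ua va].
rewrite aw imset_f // !inE.
have [_ wa swa] := hyperarcs_fromP (gs w).
rewrite -aw in wa swa.
apply/negPn; rewrite !negb_or -!andbA; apply/negP=> /and4P[wu wv wsu wsv].
have swu : s w != u by apply: contraNneq wsu => <-; rewrite permK.
have swv : s w != v by apply: contraNneq wsv => <-; rewrite permK.
have : uniq [:: u; v; w; s w].
  by rewrite /= !inE !negb_or uv !(eq_sym u) !(eq_sym v) wu wv swu swv eq_sym
    transitive_neq // ltnW.
move/card_uniqP => /= c4.
have : #|[:: u; v; w; s w]| <= #|[set x in a]|.
  apply/subset_leq_card/subsetP=> x; rewrite !inE.
  by case/or4P=> /eqP ->.
by rewrite c4 (card_supp HA Aa) k_3.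
Qed.

(** The double count limits the size of a violating [S], while inclusion-exclusion on one, two or
    three of its pairs, minus the used hyperarcs, leaves many hyperarcs and so forces [S] to be
    large. *)
Lemma hall_other_pairs (S : {set {set V}}) :
  [\/ k = 3 /\ 7 <= n, n = 7 /\ k = 4 | [/\ 8 <= n, 4 <= k & k <= n - 3]] ->
  S \subset D -> #|S| <= #|\bigcup_(P in S) N' P|.
Proof.
move=> regime SD; rewrite leqNgt; apply/negP=> few.
have weight := hyperarcs_over_pairs_weight SD.
have loss := hyperarcs_over_pairs_loss S.
have Spair P : P \in S -> #|P| = 2.
  by move/(subsetP SD); rewrite inE => /andP[/eqP].
have sup2 P : P \in S -> #|sup P| = 'C(n - 2, k - 2).
  by move=> SP; rewrite card_hyperarcs_over // (Spair P SP) // ltnW.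
have supS P : P \in S -> sup P \subset \bigcup_(P in S) sup P.
  by move=> SP; apply: (bigcup_sup P).
have NS P : P \in S -> #|N' P| <= #|\bigcup_(P in S) N' P|.
  by move=> SP; apply: subset_leq_card; apply: (bigcup_sup P).
have supI P Q : P \in S -> Q \in S -> P != Q -> #|sup P :&: sup Q| <= 'C(n - 3, k - 3).
  by move=> /Spair cP /Spair cQ; apply: card_hyperarcs_overI.
have one : 0 < #|S| -> 'C(n - 2, k - 2) <= #|\bigcup_(P in S) sup P|.
  case/card_gt0P=> P SP; rewrite -(sup2 P SP); exact/subset_leq_card/supS.
have two : 1 < #|S| -> 2 * 'C(n - 2, k - 2) <= #|\bigcup_(P in S) sup P| + 'C(n - 3, k - 3).
  case/card_gt1P=> P [Q [SP SQ nPQ]].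
  by have := cardsU_ge (supS P SP) (supS Q SQ) (supI P Q SP SQ nPQ); rewrite !sup2 // addnn mul2n.
have three : 2 < #|S| ->
    3 * 'C(n - 2, k - 2) <= #|\bigcup_(P in S) sup P| + 3 * 'C(n - 3, k - 3).
  case/card_gt2P=> P [Q [Q' [[SP SQ SQ'] [n1 n2 n3']]]].
  have := cardsU3_ge (supS P SP) (supS Q SQ) (supS Q' SQ') (supI P Q SP SQ n1)
    (supI P Q' SP SQ' _) (supI Q Q' SQ SQ' n2).
  by rewrite !sup2 // eq_sym => /(_ n3'); lia.
case: regime => [[k_3 n7]|[n7 k4]|[n8 k4 kn]].
- have lossP : 0 < #|S| -> 'C(n - 2, k - 2) <= #|\bigcup_(P in S) N' P| + 4.
    case/card_gt0P=> P SP; rewrite -(sup2 P SP).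
    have := triples_over_pair_loss k_3 (subsetP SD P SP); have := NS P SP; lia.
  move: weight loss one two three lossP few.
  move: #|\bigcup_(P in S) sup P| #|\bigcup_(P in S) _| #|S| n n7 => x u t m m7.
  rewrite k_3 bin1 bin0 -['C(3, 2)]/3 -[3.-1]/2 => weight loss one two three lossP few.
  have [t2|t3] := leqP t 2.
    have [t1|t1] := leqP t 1; first by have := lossP (leq_ltn_trans (leq0n u) few); lia.
    by have := two t1; lia.
  (* Three pairs give [t >= 2m - 8], while the weight gives [t(m - 5) <= 2m - 3]; these clash once
     [m >= 7]. *)
  have h1 := three t3.
  have h2 : 2 * m - 8 <= t by lia.
  have : (2 * m - 8) * (m - 5) <= t * (m - 5) by rewrite leq_mul2r h2 orbT.
  nia.
- move: weight loss one two few.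
  move: #|\bigcup_(P in S) sup P| #|\bigcup_(P in S) _| #|S| => x u t.
  rewrite k4 n7 -['C(4, 2)]/6 -['C(7 - 2, 4 - 2)]/10 -['C(7 - 3, 4 - 3)]/4.
  move=> weight loss one two few.
  have [t1|t1] := leqP t 1; first by have := one (leq_ltn_trans (leq0n u) few); lia.
  by have := two t1; lia.
have [] := @bin_ge_quadratic (n - 2) (k - 2); [lia|lia|lia|].
have -> : k - 2 + 2 = k by lia.
move: weight loss few; case: (posnP #|S|) => [-> //|t0]; have := one t0.
move: 'C(n - 2, k - 2) 'C(k, 2) #|S| #|\bigcup_(P in S) sup P| #|\bigcup_(P in S) _| n n8 => N K t x u m m8.
(* One pair leaves [u >= N - m >= K]. As [t > u] and [N >= K + m], this violates the weight
   inequality. *)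
nia.
Qed.

End Completion.

(** * Distinct hyperarcs for a Hamiltonian cycle *)

Section Cycles.

Variables (V : finType) (k : nat) (A : {set k.-tuple V}).
Hypothesis (HA : is_ktournament A).

Local Notation sup := (hyperarcs_over A).
Local Notation arcs := (hyperarcs_from A).
Local Notation n := #|V|.
Local Notation N := 'C(#|V| - 2, k - 2).

(** The disjunct [u == v] supplies the reflexivity contained in [total]; [N] is the number of
    hyperarcs over a pair. *)
Definition majority_arc u v := (u == v) || (N <= 2 * #|arcs u v|).

Definition cycle_hyperarcs (s : {perm V}) v := arcs v (s v).

Hypothesis (k3 : 2 < k).

Lemma card_hyperarcs_from_opp u v : u != v -> #|arcs u v| + #|arcs v u| = N.
Proof.
by move=> uv; rewrite (card_hyperarcs_from _ uv) card_hyperarcs_over // cards2 uv // ltnW.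
Qed.

Lemma majority_total : total majority_arc.
Proof.
move=> u v; rewrite /majority_arc; case: (eqVneq u v) => //= uv.
have := card_hyperarcs_from_opp uv; move: #|_| #|_| => x y <-; lia.
Qed.

Section Transitive.

Variables (s : {perm V}).
Hypotheses (sc : forall u v, fconnect s u v) (n3 : 2 < n).

Local Notation arc := (cycle_hyperarcs s).

Lemma transitive_closed (P : {pred V}) x :
  (forall v, v \in P -> s v \in P) -> x \in P -> forall v, v \in P.
Proof.
move=> PS Px v; case/connectP: (sc x v) => p + ->.
by elim: p x Px => //= y p IHp x Px /andP[/eqP <-]; apply/IHp/PS.
Qed.

Lemma majority_cycle v : majority_arc v (s v) = (N <= 2 * #|arc v|).
Proof. by rewrite /majority_arc eq_sym (negPf (transitive_neq sc v _)) // ltnW. Qed.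

(** The index being treated lies outside [J], so fewer than [n] hyperarcs have been taken. *)
Lemma assign_large D f : representatives arc D f ->
  (forall v, v \notin D -> n <= #|arc v|) ->
  exists g, representatives arc setT g.
Proof.
move=> fD large; apply: (extend_representatives fD) => v J h nDv nJv _.
apply: leq_trans (large v nDv); apply: (@leq_trans #|h @: J|.+1).
  by rewrite ltnS subset_leq_card // subsetIr.
apply: (@leq_trans #|J|.+1); first by rewrite ltnS leq_imset_card.
by rewrite -cardsT; apply: proper_card; apply/properP; split=> //; exists v; rewrite ?inE.
Qed.

(** A hyperarc with three vertices cannot contain two disjoint cycle arcs. Only the arcs before and
    after that of [v] can have taken hyperarcs of [arc v], so at most two are gone. *)
Lemma assign_triples D f : k = 3 -> representatives arc D f ->
  (forall v, v \notin D -> 3 <= #|arc v|) ->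
  exists g, representatives arc setT g.
Proof.
move=> k_3 fD large; apply: (extend_representatives fD) => v J h nDv nJv [hN _].
apply: leq_trans (large v nDv).
apply: (@leq_ltn_trans #|h @: [set s v; (s^-1)%g v]|); last first.
  by apply: leq_trans (leq_imset_card _ _) _; rewrite cards2; case: (_ != _).
apply/subset_leq_card/subsetP=> a /setIP[/hyperarcs_fromP[Aa va sva]].
case/imsetP=> w Jw aw; rewrite aw imset_f //.
have [_ wa swa] := hyperarcs_fromP (hN w Jw); rewrite -aw in wa swa.
rewrite !inE; apply/negPn; rewrite negb_or; apply/negP=> /andP[wsv wv].
have nwv : w != v by apply: contraNneq nJv => <-.
have nsw : s w != v by apply: contraNneq wv => <-; rewrite permK.
have : uniq [:: v; s v; w; s w].
  have nss x : x != s x by rewrite eq_sym transitive_neq // ltnW.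
  by rewrite /= !inE !negb_or (inj_eq perm_inj) !nss !(eq_sym v) nwv nsw eq_sym wsv.
move/card_uniqP => /= c4.
have : #|[:: v; s v; w; s w]| <= #|[set x in a]|.
  by apply/subset_leq_card/subsetP=> x; rewrite !inE; case/or4P=> /eqP ->.
by rewrite c4 (card_supp HA Aa) k_3.
Qed.

End Transitive.

Lemma fconnect_inv (s : {perm V}) :
  (forall u v, fconnect s u v) -> forall u v, fconnect (s^-1)%g u v.
Proof.
move=> sc u; suff all : forall w, connect (frel (s^-1)%g) w u.
  move=> v; suff: v \in [pred w | connect (frel (s^-1)%g) u w] by [].
  have H : forall w, w \notin [pred w | connect (frel (s^-1)%g) u w] ->
      s w \notin [pred w | connect (frel (s^-1)%g) u w].
    move=> w; apply: contra; rewrite !inE => c; apply: connect_trans c _.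
    by apply: connect1; rewrite /= permK.
  apply/negPn/negP=> nv.
  have := @transitive_closed s sc [pred w | w \notin [pred w | connect (frel (s^-1)%g) u w]] v _ nv u.
  by rewrite !inE connect0 => /(_ H).
move=> w; suff: w \in [pred w | connect (frel (s^-1)%g) w u] by [].
apply: (@transitive_closed s sc _ u); rewrite ?inE // => v; rewrite !inE.
by apply: connect_trans; apply: connect1; rewrite /= permK.
Qed.

Lemma fconnect_conj (s t : {perm V}) :
  (forall u v, fconnect s u v) -> forall u v, fconnect (s ^ t)%g u v.
Proof.
move=> sc u v; rewrite -(permKV t u) -(permKV t v).
move: ((t^-1)%g u) ((t^-1)%g v) => {}u {}v.
case/connectP: (sc u v) => p pp ->; apply/connectP; exists (map t p); last by rewrite last_map.
rewrite path_map; apply: sub_path pp => x y /= /eqP <-.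
by rewrite permJ.
Qed.

End Cycles.

(** * The exceptional case of seven vertices and hyperarcs of size four *)

Section SevenFour.

Variables (V : finType) (k : nat) (A : {set k.-tuple V}).
Hypothesis (HA : is_ktournament A).

Local Notation sup := (hyperarcs_over A).
Local Notation arcs := (hyperarcs_from A).
Local Notation n := #|V|.
Local Notation N := 'C(#|V| - 2, k - 2).
Local Notation majority := (majority_arc A).
Local Notation arc s := (cycle_hyperarcs A s).

Hypotheses (n7 : n = 7) (k4 : k = 4).

Let k3 : 2 < k. Proof. by rewrite k4. Qed.
Let n3 : 2 < n. Proof. by rewrite n7. Qed.

Lemma card_arcs74 u v : u != v -> #|arcs u v| + #|arcs v u| = 10.
Proof. by move=> uv; rewrite (card_hyperarcs_from_opp HA) // n7 k4. Qed.

Lemma majority74 u v : majority u v = (u == v) || (4 < #|arcs u v|).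
Proof.
rewrite /majority_arc n7 (_ : 'C(_, _) = 10); last by rewrite k4.
by case: (u == v) => //=; apply/idP/idP; lia.
Qed.

Section Transitive.

Variables (s : {perm V}).
Hypotheses (sc : forall u v, fconnect s u v).

(** Distinct arcs of the cycle span at least three vertices, and three given vertices lie in
    ['C(4, 1) = 4] hyperarcs. *)
Lemma cycle_arcsI u v : u != v -> #|arc s u :&: arc s v| <= 4.
Proof.
move=> uv; apply: leq_trans (subset_leq_card (setISS (hyperarcs_from_sub A _ _) (hyperarcs_from_sub A _ _))) _.
have -> : 4 = 'C(n - 3, k - 3) by rewrite n7 k4.
have nss w : w != s w by rewrite eq_sym (transitive_neq sc) // ltnW.
apply: card_hyperarcs_overI; rewrite ?cards2 ?nss //.
apply/eqP=> e; have := set21 u (s u); have := set22 u (s u); rewrite e !inE (negPf uv) /=.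
rewrite (inj_eq perm_inj) (negPf uv) orbF => /eqP sv /eqP us.
by have := transitive_neq2 sc v n3; rewrite -us sv eqxx.
Qed.

Lemma disjoint_arcsI u v : u != v -> s u != v -> s v != u ->
  #|arc s u :&: arc s v| <= 1.
Proof.
move=> uv suv svu; apply: leq_trans (subset_leq_card (setISS (hyperarcs_from_sub A _ _) (hyperarcs_from_sub A _ _))) _.
rewrite hyperarcs_overI.
have -> : 1 = 'C(n - 4, k - 4) by rewrite k4 subnn bin0.
apply: card_hyperarcs_over_ge; rewrite ?k4 //.
have nss w : w != s w by rewrite eq_sym (transitive_neq sc) // ltnW.
have /card_uniqP /= <- : uniq [:: u; s u; v; s v].
  by rewrite /= !inE !negb_or (inj_eq perm_inj) !nss uv suv (eq_sym u) svu.
by apply/subset_leq_card/subsetP=> x; rewrite !inE -!orbA.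
Qed.

(** Three pairwise adjacent arcs would close up to a triangle of [s], which a cycle of length seven
    excludes. *)
Lemma disjoint_arcs_in (S : {set V}) : 2 < #|S| ->
  exists u v, [/\ u \in S, v \in S & [&& u != v, s u != v & s v != u]].
Proof.
case/card_gt2P=> x [y [z [[Sx Sy Sz] [xy yz zx]]]].
have [H|] := boolP ((s x != y) && (s y != x)); first by exists x, y; rewrite xy.
have [H _|] := boolP ((s y != z) && (s z != y)); first by exists y, z; rewrite yz.
have [H _ _|] := boolP ((s z != x) && (s x != z)); first by exists z, x; rewrite zx.
have no3 a b c : s a = b -> s b = c -> s c = a -> False.
  move=> e1 e2 e3; have := @transitive_fcycle _ s sc [:: a; b; c].
  by rewrite /= e1 e2 e3 !eqxx n7 => /(_ isT isT).
have sinj a b c : s a = c -> s b = c -> a = b by move=> <- /perm_inj.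
rewrite !negb_and !negbK.
case/orP=> /eqP e1; case/orP=> /eqP e2; case/orP=> /eqP e3.
- by case: (no3 x y z).
- by rewrite -e2 -e3 eqxx in zx.
- by rewrite -e1 -e2 eqxx in xy.
- by rewrite -e1 -e2 eqxx in xy.
- by rewrite (sinj _ _ _ e1 e2) eqxx in xy.
- by rewrite (sinj _ _ _ e1 e2) eqxx in xy.
- by rewrite -e1 -e3 eqxx in yz.
- by case: (no3 x z y).
Qed.

(** Hall's condition outside [D], after deleting the [#|D|] reserved hyperarcs: one arc has at least
    5 hyperarcs, two have at least [5 + 5 - 4], and three or more include two disjoint ones with at
    least [5 + 5 - 1 = 9], enough because [#|S| + #|D| <= 7]. *)
Lemma assign_few_bad D f : representatives (arc s) D f -> #|D| <= 4 ->
  (forall v, v \notin D -> 4 < #|arc s v|) ->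
  exists g, representatives (arc s) setT g.
Proof.
move=> fD D4 good.
have /card_gt0P[v0 _] : 0 < #|V| by rewrite n7.
have [S SD|h hD] := @hall_marriage _ _ (fun v => arc s v :\: f @: D) (~: D) (f v0); last first.
  exact: representatives_cat fD hD.
set U := \bigcup_(i in S) _; pose U' := \bigcup_(i in S) arc s i.
have sU v : v \in S -> arc s v \subset U' by move=> Sv; apply: (bigcup_sup v).
have gS v : v \in S -> 4 < #|arc s v|.
  by move=> /(subsetP SD); rewrite inE => /good.
have cUU : #|U'| <= #|U| + #|D|.
  apply: leq_trans (leq_add (leqnn _) (leq_imset_card f D)).
  apply: leq_trans (leq_card_setU _ _).1.
  apply/subset_leq_card/bigcupsP=> v Sv; apply/subsetP=> a av; rewrite inE.
  have [aR|naR] := boolP (a \in f @: D); rewrite ?orbT // orbF.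
  by apply/bigcupP; exists v => //; rewrite inE naR.
have cS : #|S| + #|D| <= 7.
  by rewrite -n7 -(cardsC D) addnC leq_add2l subset_leq_card.
have [S2|S3] := leqP #|S| 2; last first.
  have [u [v [Su Sv /and3P[uv suv svu]]]] := disjoint_arcs_in S3.
  have := cardsU_ge (sU _ Su) (sU _ Sv) (disjoint_arcsI uv suv svu).
  have := gS _ Su; have := gS _ Sv; lia.
have [S1|S2'] := leqP #|S| 1; last first.
  have /card_gt1P[u [v [Su Sv uv]]] := S2'.
  have := cardsU_ge (sU _ Su) (sU _ Sv) (cycle_arcsI uv).
  have := gS _ Su; have := gS _ Sv; lia.
have [->//|S0] := posnP #|S|.
have /card_gt0P[u Su] := S0.
have := subset_leq_card (sU _ Su); have := gS _ Su; lia.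
Qed.

End Transitive.

(** The arc of the reversed cycle at [s v] ends at [v], so a system indexed by the arcs of [s] is
    carried over along [s]. *)
Lemma assign_reverse (s : {perm V}) D f : (forall u v, fconnect s u v) ->
  representatives (fun v => arcs (s v) v) D f -> #|D| <= 4 ->
  (forall v, v \notin D -> 4 < #|arcs (s v) v|) ->
  exists g, representatives (arc s^-1%g) setT g.
Proof.
move=> sc [fN finj] D4 good.
apply: (@assign_few_bad _ (fconnect_inv sc) (s @: D) (f \o s^-1%g)).
- split=> [_ /imsetP[v Dv ->]|_ _ /imsetP[u Du ->] /imsetP[v Dv ->]].
    by rewrite /cycle_hyperarcs /= permK fN.
  by rewrite /= !permK => /(finj _ _ Du Dv) ->.
- by rewrite card_imset //; apply: perm_inj.
move=> v nDv; rewrite /cycle_hyperarcs -{1}(permKV s v); apply: good.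
by apply: contra nDv => D'; apply/imsetP; exists (s^-1%g v); rewrite ?permKV.
Qed.

Definition assignable := exists s : {perm V}, (forall u v, fconnect s u v) /\
  exists g, representatives (arc s) setT g.

Section ManyBad.

Variables (s : {perm V}) (D : {set V}) (f : V -> k.-tuple V).
Hypotheses (sc : forall u v, fconnect s u v) (fD : representatives (arc s) D f).
Hypothesis (badD : {in D, forall v, #|arc s v| <= 4}).
Hypothesis (goodD : forall v, v \notin D -> 4 < #|arc s v|).
Hypothesis (nstrong : ~ forall u v, connect majority u v).

Local Notation M v := (arcs (s v) v).

Let nss w : w != s w. Proof. by rewrite eq_sym (transitive_neq sc) // ltnW. Qed.

Lemma reverse_good v : v \in D -> 5 < #|M v|.
Proof. by move=> /badD; rewrite /cycle_hyperarcs; have := card_arcs74 (nss v); lia. Qed.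

Lemma card_arc_rev v : #|arc s v| + #|M v| = 10.
Proof. exact: card_arcs74 (nss v). Qed.

(** Reversing all arcs of the cycle except that at [w] gives a Hamiltonian path of the majority
    digraph from [w] to [s w]. A majority connection from [s w] to [w] would then make this digraph
    strong. *)
Lemma reverse_to (w : V) : (forall v, v != w -> majority (s v) v) ->
  forall v, connect majority v (s w).
Proof.
move=> rev v; suff: v \in [pred v | connect majority v (s w)] by [].
apply: (transitive_closed sc (x := s w)); rewrite ?inE // => u.
rewrite !inE => cu; have [-> //|uw] := eqVneq u w.
by apply: connect_trans cu; apply/connect1/rev.
Qed.

Lemma reverse_from (w : V) : (forall v, v != w -> majority (s v) v) ->
  forall v, connect majority w v.
Proof.
move=> rev v; apply/negPn/negP=> nv.
have closed u : u \in [pred v | ~~ connect majority w v] ->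
    s u \in [pred v | ~~ connect majority w v].
  rewrite !inE; apply: contra => cu; have [-> //|uw] := eqVneq u w.
  by apply: connect_trans cu _; apply/connect1/rev.
by have := transitive_closed sc closed nv w; rewrite inE connect0.
Qed.

(* The arc (u, s u) can be generated only by the hyperarcs already assigned to the
   five bad arcs. All of these therefore contain u before s u, so they still
   generate the bad arcs of the cycle in which u and s u are exchanged. *)
Lemma assign_swap u w : u != w -> D = ~: [set u; w] -> arc s u \subset f @: D ->
  #|M w| = 0 -> assignable.
Proof.
move=> uw DE NuR Mw.
have [fN finj] := fD.
have cD : #|D| = 5 by have := cardsC [set u; w]; rewrite -DE cards2 uw n7; lia.
have cR : #|f @: D| = 5 by rewrite card_in_imset.
have Dv v : v != u -> v != w -> v \in D by move=> vu vw; rewrite DE !inE negb_or vu.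
have nDu : u \notin D by rewrite DE !inE eqxx.
have nDw : w \notin D by rewrite DE !inE eqxx orbT.
set v := s u; have uv : u != v := nss u.
have NuE : arc s u = f @: D.
  by apply/eqP; rewrite eqEcard NuR cR; apply: goodD.
have Mu : #|M u| = 5 by have := card_arc_rev u; rewrite NuE cR; lia.
have rev x : x != w -> majority (s x) x.
  move=> xw; rewrite majority74; have [-> |xu] := eqVneq x u; first by rewrite Mu orbT.
  by rewrite (ltnW (reverse_good (Dv _ xu xw))) orbT.
pose t := tperm u v.
exists (s ^ t)%g; split; first exact: fconnect_conj sc.
have arct x : arc (s ^ t)%g (t x) = arcs (t x) (t (s x)).
  by rewrite /cycle_hyperarcs permJ.
have su x : x != u -> s x != v by apply: contraNneq => e; apply/eqP/(@perm_inj _ s).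
have ft x : x \in D -> f x \in arcs (t x) (t (s x)).
  move=> Dx; have xu : x != u by apply: contraNneq nDu => <-.
  have := fN x Dx; have : f x \in arc s u by rewrite NuE imset_f.
  rewrite /cycle_hyperarcs !inE -/v => /andP[-> p1] /andP[_ p2] /=.
  rewrite (_ : t (s x) = if s x == u then v else s x); last first.
    by rewrite /t; case: tpermP => [->|e|/eqP/negPf ->]; rewrite ?eqxx //; case/eqP: (su x xu).
  have [xv|xv] := eqVneq x v.
    have sxu : s x != u by rewrite xv; exact: transitive_neq2 sc _ n3.
    by move: p1 p2; rewrite (negPf sxu) xv /t tpermR; apply: precedes_trans.
  rewrite /t tpermD ?(eq_sym u) ?(eq_sym v) //.
  case: eqVneq => // sxu; rewrite sxu in p2; exact: precedes_trans p2 p1.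
have tD : representatives (arc (s ^ t)%g) (t @: D) (f \o t).
  split=> [_ /imsetP[x Dx ->]|_ _ /imsetP[x Dx ->] /imsetP[y Dy ->]].
    by rewrite arct /= tpermK ft.
  by rewrite /= !tpermK => /(finj _ _ Dx Dy) ->.
have tR : (f \o t) @: (t @: D) = f @: D.
  by rewrite -imset_comp; apply: eq_imset => x /=; rewrite tpermK.
(* Exchanging [u] and [v] alters the arc at [w] only if [w = v] or [s w = u]. Were the opposite of
   the new arc then a majority arc, it would, with the majority arc [(u, v)], lead from [s w] to [w]
   and make the majority digraph strong. *)
have wbig : 5 < #|arc (s ^ t)%g (t w)|.
  have sw_to := reverse_to rev; have w_from := reverse_from rev.
  have through a b : connect majority (s w) a -> majority a b -> connect majority b w ->
      False.
    move=> c1 ab c2; apply: nstrong => x y.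
    apply: connect_trans (sw_to x) _; apply: connect_trans c1 _.
    by apply: connect_trans (connect1 ab) _; apply: connect_trans c2 _.
  have Nw : #|arc s w| = 10 by have := card_arc_rev w; rewrite Mw addn0.
  rewrite arct; have [wv|wv] := eqVneq w v.
    have swu : s w != u by rewrite wv; exact: transitive_neq2 sc _ n3.
    have -> : t (s w) = s w by rewrite /t tpermD // eq_sym // su // eq_sym.
    rewrite wv /t tpermR -wv.
    have : ~~ majority (s w) u.
      apply/negP=> mj; apply: (through _ _ (connect0 _ _) mj).
      by apply: connect1; rewrite majority74 wv /v -/(arc s u) NuE cR orbT.
    rewrite majority74 negb_or -leqNgt => /andP[_]; have := card_arcs74 swu; lia.
  have tw : t w = w by rewrite /t tpermD // eq_sym.
  have [swu|swu] := eqVneq (s w) u; last first.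
    have -> : t (s w) = s w by rewrite /t tpermD // eq_sym // su // eq_sym.
    by rewrite tw -/(arc s w) Nw.
  rewrite tw swu /t tpermL.
  have : ~~ majority v w.
    apply/negP=> mj; apply: (through v w _ mj (connect0 _ _)).
    by rewrite swu; apply: connect1; rewrite majority74 -/(arc s u) NuE cR orbT.
  rewrite majority74 negb_or -leqNgt => /andP[_]; have := card_arcs74 wv; lia.
have [a aw naR] : exists2 a, a \in arc (s ^ t)%g (t w) & a \notin f @: D.
  apply/subsetPn; apply: contraL wbig => /subset_leq_card; rewrite cR; lia.
have tinj : injective t by apply: perm_inj.
have ntw : t w \notin t @: D by rewrite mem_imset.
rewrite -tR in naR.
have [h hP hR] := representatives_add tD ntw aw naR.
have ntu : t u \notin t w |: t @: D.
  by rewrite in_setU1 (inj_eq tinj) mem_imset // negb_or uw.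
(* The new arc [(v, u)] has five hyperarcs, all outside [f @: D] because those list [u] before [v];
   at most the one given to [t w] is taken. *)
have [b bu nb] : exists2 b, b \in arc (s ^ t)%g (t u) & b \notin h @: (t w |: t @: D).
  have -> : arc (s ^ t)%g (t u) = arcs v u by rewrite arct /t tpermL tpermR.
  have dR : [disjoint arcs v u & f @: D].
    rewrite -NuE disjoint_sym; apply/pred0P=> x /=; rewrite !inE.
    apply/negbTE/negP=> /andP[/andP[_ p] /andP[_ p']].
    by case/and3P: (p) => ux vx _; have := precedes_total uv ux vx; rewrite p p'.
  have : 0 < #|arcs v u :\ a| by have := cardsD1 a (arcs v u); rewrite Mu; case: (_ \in _); lia.
  case/card_gt0P=> b /setD1P[ba bvu]; exists b => //.
  by rewrite hR in_setU1 negb_or ba tR (disjointFr dR bvu).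
have [h' h'P _] := representatives_add hP ntu bu nb.
exists h'; rewrite (_ : setT = t u |: (t w |: t @: D)) //.
apply/setP=> x; rewrite -(tpermK u v x) -/t !in_setU1 !(inj_eq tinj) mem_imset // DE !inE.
by case: (t x == u); case: (t x == w).
Qed.

(** At most two arcs lie outside [D], and in the reversed cycle only these need reserved hyperarcs.
    What an arc lacks in one direction it has in the other, as ten hyperarcs lie over each pair. *)
Lemma assign_many_bad : 4 < #|D| -> assignable.
Proof.
move=> D5; have cD := cardsC D; rewrite n7 in cD.
have nil : representatives (fun v => M v) set0 f by split=> [v|v v']; rewrite inE.
have rev D1 h : representatives (fun v => M v) D1 h -> D1 = ~: D -> assignable.
  move=> hP D1E; exists (s^-1)%g; split; first exact: fconnect_inv.
  apply: (assign_reverse sc hP); first by rewrite D1E; lia.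
  move=> v; rewrite D1E inE negbK => /reverse_good; exact: ltnW.
have fwd D1 h : representatives (arc s) D1 h -> ~: D1 = set0 -> assignable.
  move=> hP D10; exists s; split=> //; exists h.
  by rewrite (_ : setT = D1) // -(setCK D1) D10 setC0.
have cR : #|f @: D| = #|D| by rewrite card_in_imset //; case: fD.
have lossR v : #|arc s v| <= #|arc s v :\: f @: D| + #|D|.
  rewrite -(cardsID (f @: D) (arc s v)) addnC leq_add2l -cR.
  by rewrite subset_leq_card // subsetIr.
have [C0|[C1|C2]] : #|~: D| = 0 \/ #|~: D| = 1 \/ #|~: D| = 2 by lia.
- by apply: (fwd _ _ fD); apply: cards0_eq.
- have /cards1P[u CE] : #|~: D| == 1 by rewrite C1.
  have nu : u \notin D by rewrite -in_setC CE set11.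
  have [|[a]] := set_0Vmem (arc s u :\: f @: D); last first.
    case/setDP=> Na nR; have [h hP _] := representatives_add fD nu Na nR.
    by apply: (fwd _ _ hP); rewrite setCU CE setIC setICr.
  move=> X0; have := lossR u; rewrite X0 cards0 => le.
  have /card_gt0P[a Ma] : 0 < #|M u| by have := card_arc_rev u; lia.
  have [||h hP _] := representatives_add nil _ Ma; rewrite ?imset0 ?inE //.
  by apply: (rev _ _ hP); rewrite CE setU0.
have D5E : #|D| = 5 by lia.
have /cards2P[u [w [uw CE]]] : #|~: D| == 2 by rewrite C2.
have nu : u \notin D by rewrite -in_setC CE set21.
have nw : w \notin D by rewrite -in_setC CE set22.
have := lossR u; have := lossR w; rewrite D5E.
have := card_arc_rev u; have := card_arc_rev w.
have fwd2 := two_representatives fD nu nw uw.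
have rev2 := @two_representatives _ _ (fun v => M v) _ _ u w nil _ _ uw.
rewrite !inE imset0 !setD0 in rev2.
have DE : D = ~: [set u; w] by rewrite -CE setCK.
have swap1 : #|arc s u :\: f @: D| = 0 -> #|M w| = 0 -> assignable.
  by move=> /cards0_eq/eqP; rewrite setD_eq0; apply: assign_swap.
have swap2 : #|arc s w :\: f @: D| = 0 -> #|M u| = 0 -> assignable.
  move=> /cards0_eq/eqP; rewrite setD_eq0; apply: assign_swap; first by rewrite eq_sym.
  by rewrite setUC.
move: fwd2 rev2 swap1 swap2.
set x := #|_ u :\: _|; set y := #|_ w :\: _|.
set Nu := #|arc s u|; set Nw := #|arc s w|.
set Mu := #|M u|; set Mw := #|M w| => fwd2 rev2 swap1 swap2 e1 e2 l1 l2.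
(* If [x = 0], then [Nu <= 5], so [Mu >= 5] and the reverse choice fails only through [Mw = 0];
   symmetrically for [y]. If [x = y = 1], both [Mu] and [Mw] are at least 4. *)
have [[x0 [y0 xy]]|[[x0 [y0 xy]]|[[x0 y0]|[x0 y0]]]] : (0 < x /\ 0 < y /\ 2 < x + y) \/
  (0 < Mu /\ 0 < Mw /\ 2 < Mu + Mw) \/ (x = 0 /\ Mw = 0) \/ (y = 0 /\ Mu = 0) by lia.
- have [h hP] := fwd2 x0 y0 xy; apply: (fwd _ _ hP).
  by rewrite DE; apply/setP=> v; rewrite !inE; case: (v == u); case: (v == w).
- have [h hP] := rev2 isT isT x0 y0 xy; apply: (rev _ _ hP).
  by rewrite CE setU0.
- exact: swap1.
- exact: swap2.
Qed.

End ManyBad.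
End SevenFour.

(** * From a strong hypertournament to an assigned Hamiltonian cycle, and the conclusion *)

Section Main.

Variables (V : finType) (k : nat) (A : {set k.-tuple V}).
Hypothesis (HA : is_ktournament A).

Local Notation arcs := (hyperarcs_from A).
Local Notation n := #|V|.
Local Notation majority := (majority_arc A).

(** The vertices of a path are distinct, so each of its arcs is determined by its tail; hence [f]
    assigns hyperarcs to vertices, matching the arcs [(v, s v)] of a cycle. *)
Lemma hpath_link u v xs ars : hpath A u v xs ars ->
  exists (B : rel V) (f : V -> k.-tuple V),
  [/\ forall x y, B x y -> f x \in arcs x y,
      {in [pred x | [exists y, B x y]] &, injective f} & connect B u v].
Proof.
case: xs => [|x0 xs] [] // sz [hu [lv [Ux [Ua [aA aP]]]]].
move: hu => /= hu; subst x0; move: sz => /= [sz].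
case: ars => [|a0 ars'] in sz Ua aA aP *.
  (* Without hyperarcs, [B] is empty and the constant tuple is a dummy value. *)
  case: xs sz lv {Ux aP} => //= _ ->; exists (fun _ _ => false), (fun=> [tuple of nseq k u]).
  split=> // x y; rewrite inE => /existsP[] //.
set ars := a0 :: ars' in sz Ua aA aP *; set ys := u :: xs in Ux aP *.
(* The bound on the index excludes both the last vertex and the vertices off the path. *)
pose B x y := (index x ys < size ars) && (y == nth u ys (index x ys).+1).
pose f x := nth a0 ars (index x ys).
have sys : size ys = (size ars).+1 by rewrite /= sz.
have Bf x y : B x y -> f x \in arcs x y.
  case/andP=> ix /eqP ->.
  rewrite inE aA ?mem_nth //=; apply: aP.
  have xys : x \in ys by rewrite -index_mem sys ltnW.
  have sz2 : size (zip ys (behead ys)) = size ars by rewrite size_zip size_behead sys; apply/minn_idPr; exact: leqnSn.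
  have -> : (f x, (x, nth u ys (index x ys).+1)) =
     nth (a0, (u, u)) (zip ars (zip ys (behead ys))) (index x ys).
    rewrite nth_zip ?sz2 //; congr (_, _).
    by rewrite nth_zip_cond sz2 ix nth_behead nth_index.
  by rewrite mem_nth // size_zip sz2 minnn.
exists B, f; split=> //.
  move=> x y; rewrite !inE => /existsP[x' /andP[ix _]] /existsP[y' /andP[iy _]] /eqP.
  rewrite nth_uniq // => /eqP e.
  have xys : x \in ys by rewrite -index_mem sys ltnW.
  have yys : y \in ys by rewrite -index_mem sys ltnW.
  by rewrite -(nth_index u xys) e nth_index.
have reach i : i <= size ars -> connect B u (nth u ys i).
  elim: i => [|i IHi] iars; first by rewrite connect0.
  apply: connect_trans (IHi (ltnW iars)) _; apply: connect1.
  by rewrite /B index_uniq ?sys // ?iars ?eqxx // ltnW.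
by rewrite -lv -[last _ _]/(last u xs) (last_nth u) sz; apply: reach.
Qed.

Hypothesis (strong : hstrong A).
Hypotheses (k3 : 2 < k) (n3 : 2 < n).

(** An arc of the Hamiltonian cycle that is not a majority arc must belong to the added path, whose
    hyperarcs are distinct. *)
Lemma majority_cycle_assignment : exists (s : {perm V}) D f,
  [/\ forall u v, fconnect s u v,
      representatives (cycle_hyperarcs A s) D f
    & forall v, (v \in D) = ~~ majority v (s v)].
Proof.
have /card_gt0P[v0 _] : 0 < n by apply: ltn_trans n3.
have tot := majority_total HA k3.
have [x xs] := total_source v0 tot.
have [|y ys] := @total_source _ (fun u v => majority v u) v0; first by move=> u v; apply: tot.
have {}ys v : connect majority v y.
  by have := ys v; rewrite connect_rev.
have [xys [ars /hpath_link[B [f [Bf finj yx]]]]] : exists xs ars, hpath A y x xs ars.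
  (* [strong] speaks of distinct vertices; equal ones are joined by the trivial path. *)
  have [<-|nyx] := eqVneq y x; last exact: strong.
  by exists [:: y], [::]; do !split.
pose E u v := majority u v || B u v.
have sub u v : connect majority u v -> connect E u v.
  by apply: connect_sub => a b mj; apply: connect1; rewrite /E mj.
have Estrong u v : connect E u v.
  apply: connect_trans (sub _ _ (ys u)) _; apply: connect_trans (sub _ _ (xs v)).
  by apply: connect_sub yx => a b Bab; apply: connect1; rewrite /E Bab orbT.
have Etot : total E.
  by move=> u v; rewrite /E; case/orP: (tot u v) => ->; rewrite ?orbT.
have [s [Es sc]] := hamiltonian_perm Etot Estrong v0.
exists s, [set v | ~~ majority v (s v)], f; split=> // [|v]; last by rewrite inE.
have BD v : v \in [set v | ~~ majority v (s v)] -> B v (s v).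
  by rewrite inE; have := Es v; rewrite /E; case: majority.
split=> [v /BD/Bf //|u v /BD Bu /BD Bv]; apply: finj; rewrite inE; apply/existsP.
  by exists (s u).
by exists (s v).
Qed.

Lemma assignable74 : n = 7 -> k = 4 -> assignable A.
Proof.
move=> n7 k4; have [s [D [f [sc fD DE]]]] := majority_cycle_assignment.
have /card_gt0P[v0 _] : 0 < n by apply: ltn_trans n3.
have nss v : (v == s v) = false by rewrite eq_sym (negPf (transitive_neq sc v (ltnW n3))).
have good v : v \notin D -> 4 < #|cycle_hyperarcs A s v|.
  by rewrite DE negbK (majority74 _ n7 k4) nss.
have bad : {in D, forall v, #|cycle_hyperarcs A s v| <= 4}.
  by move=> v; rewrite DE (majority74 _ n7 k4) nss /= -leqNgt.
have [D4|D5] := leqP #|D| 4.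
  by exists s; split=> //; apply: (assign_few_bad HA n7 k4 sc fD).
(* A strong majority digraph has a Hamiltonian cycle made of majority arcs alone, so nothing has to
   be reserved. *)
have [/forallP mstr|nstr] := boolP [forall u, forall v, connect majority u v].
  have [s' [ms' sc']] := hamiltonian_perm (majority_total HA k3) (fun u => forallP (mstr u)) v0.
  exists s'; split=> //.
  apply: (@assign_few_bad _ _ _ HA n7 k4 _ sc' set0 f); rewrite ?cards0 //.
    by split=> [v|u v]; rewrite inE.
  move=> v _; have := ms' v; rewrite (majority74 _ n7 k4) eq_sym.
  by rewrite (negPf (transitive_neq sc' v (ltnW n3))).
apply: (assign_many_bad HA n7 k4 sc fD bad good _ D5).
by move=> mstr; case/negP: nstr; apply/forallP=> u; apply/forallP=> v.
Qed.

Lemma assignable_hypertournament :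
  [\/ k = 3 /\ 7 <= n, n = 7 /\ k = 4 | [/\ 8 <= n, 4 <= k & k <= n - 3]] -> assignable A.
Proof.
case=> [[k_3 n7]|[n7 k4]|[n8 k4 kn]]; last 1 first.
- have [s [D [f [sc fD DE]]]] := majority_cycle_assignment; exists s; split=> //.
  apply: (assign_large fD) => v; rewrite DE negbK (majority_cycle _ sc n3).
  (* The second bound reads [2n - 1 <= 'C(n - 2, k - 2)], so a majority arc has at least [n]
     hyperarcs. *)
  have [||| _ +] := @bin_ge_quadratic (n - 2) (k - 2); [lia|lia|lia|].
  move: #|cycle_hyperarcs A s v| 'C(n - 2, k - 2) => x y; lia.
- have [s [D [f [sc fD DE]]]] := majority_cycle_assignment; exists s; split=> //.
  apply: (assign_triples HA sc n3 k_3 fD) => v; rewrite DE negbK (majority_cycle _ sc n3).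
  (* A majority arc has at least half of [n - 2 >= 5] hyperarcs, hence three. *)
  have -> : 'C(n - 2, k - 2) = n - 2 by rewrite k_3 bin1.
  move: #|cycle_hyperarcs A s v| => x; lia.
- exact: assignable74.
Qed.

End Main.

Theorem theorem4 (V : finType) (n k : nat) (A : {set k.-tuple V}) :
  #|V| = n -> 7 <= n -> 3 <= k -> k <= n - 3 ->
  is_ktournament A -> hstrong A ->
  exists T : rel V, [/\ is_tournament T, generated_by A T & tstrong T].
Proof.
move=> <- n7 k3 kn HA strong.
have n3 : 2 < #|V| by apply: leq_trans n7.
have regime : [\/ k = 3 /\ 7 <= #|V|, #|V| = 7 /\ k = 4
                | [/\ 8 <= #|V|, 4 <= k & k <= #|V| - 3]].
  have [k_3|k4] : k = 3 \/ 4 <= k by lia.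
    by constructor 1.
  have [n_7|n8] : #|V| = 7 \/ 8 <= #|V| by lia.
    by constructor 2; split=> //; lia.
  by constructor 3.
have [s [sc [g [gs ginj]]]] := assignable_hypertournament HA strong k3 n3 regime.
have {}gs v : g v \in hyperarcs_from A v (s v) by apply: gs; rewrite inE.
have {}ginj : injective g by move=> u v; apply: ginj; rewrite inE.
have /card_gt0P[v0 _] : 0 < #|V| by apply: leq_trans n7.
have [S SD|h [hN hinj]] := @hall_marriage _ _
  (fun P => hyperarcs_over A P :\: used_hyperarcs g) (other_pairs s) (g v0).
  exact: hall_other_pairs.
exact: (complete_cycle sc gs ginj n3 hN hinj).
Qed.
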